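(* Let $A,C\in\mathbb R^{m\times n}$ be non-zero matrices and $\beta\in\mathbb R^n$ a non-zero vector such that the polyhedra $P$ and $Q'$ are non-degenerate. Let $\alpha\in\mathbb R^m$ be such that $G(\alpha)=(A,C+\alpha\beta^T)$ is a non-degenerate game with $A>0$ and $C+\alpha\beta^T>0$ entrywise. Let $H:\ \lambda-\sum_{i=1}^m\alpha_ix_i=0$, $H^-:\ \lambda-\sum_{i=1}^m\alpha_ix_i\le0$, $H^+:\ \lambda-\sum_{i=1}^m\alpha_ix_i\ge0$. Let an edge $\overline{u,u'}$ of $\mathcal N$ intersect $H$ at a Nash equilibrium $(x,y)$ of $G(\alpha)$ (i.e. at a point $((y,\pi_1),(x,\lambda,\pi_2))$), and let $\rightarrow(\overline{u,u'})=\overrightarrow{u,u'}$, i.e. the edge is oriented from $u$ to $u'$. If $u\in H^-$ and $u'\in H^+$, then the index of $(x,y)$ is $+1$; otherwise it is $-1$.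
   Context: Let $S_1=\{1,\dots,m\}$, $S_2=\{1,\dots,n\}$. For a matrix $M$, $M_i$ is its $i$-th row, $M^j$ its $j$-th column, $M_X^Y$ the submatrix with rows $X$ and columns $Y$; $1_{p\times q}$ is the all-ones matrix, $I_p$ the identity. A Nash equilibrium of a game $(A,B)$ is a pair $(x,y)$ of probability vectors $x\in\mathbb R^m$, $y\in\mathbb R^n$ with $x^TAy\ge x'^TAy$ and $x^TBy\ge x^TBy'$ for all probability vectors $x'\in\mathbb R^m$, $y'\in\mathbb R^n$. $P=\{(y,\pi_1)\in\mathbb R^{n+1}: A_iy-\pi_1\le0\ (i\in S_1);\ y_j\ge0\ (j\in S_2);\ \sum_j y_j=1\}$ (dimension $n$). $Q'=\{(x,\lambda,\pi_2)\in\mathbb R^{m+2}: x_i\ge0\ (i\in S_1);\ x^TC^j+\beta_j\lambda-\pi_2\le0\ (j\in S_2);\ \sum_i x_i=1\}$ (dimension $m+1$). For a game $(A,B)$, $Q=\{(x,\pi_2)\in\mathbb R^{m+1}: x_i\ge0\ (i\in S_1);\ x^TB^j-\pi_2\le0\ (j\in S_2);\ \sum_ix_i=1\}$ (dimension $m$). In all these polyhedra the inequalities indexed by $i\in S_1$ are numbered $1,\dots,m$ and those indexed by $j\in S_2$ are numbered $m+1,\dots,m+n$; $L(\cdot)$ is the set of numbers of tight inequalities at a point. $\mathcal N=\{(v,w)\in P\times Q': L(v)\cup L(w)=\{1,\dots,m+n\}\}$. Non-degeneracy of a polyhedron of dimension $D$ among these: every point in the relative interior of a $d$-dimensional face has exactly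 $D-d$ tight inequalities. The game $(A,B)$ is non-degenerate if $P$ and $Q$ are. Under non-degeneracy of $P,Q'$, $\mathcal N$ is a union of vertices and edges of $P\times Q'$; at each vertex $u=(v,w)$ of $\mathcal N$ there is exactly one duplicate label in $L(v)\cap L(w)$, and exactly two edges of $\mathcal N$ are incident to $u$: one of the form $\mathcal E_w\times\{w\}$ (relax the duplicate label's inequality in $P$), with $\mathcal E_w=\{v':(v',w)\in\mathcal N\}$, and one of the form $\{v\}\times\mathcal E_v$ (relax it in $Q'$), with $\mathcal E_v=\{w':(v,w')\in\mathcal N\}$. Sign of a vertex $u=(v,w)$ of $\mathcal N$, $v=(y,\pi_1)$, $w=(x,\lambda,\pi_2)$: let $X=\{i: A_iy=\pi_1\}$, $Y=\{j: x^TC^j+\beta_j\lambda=\pi_2\}$ be ordered sets, with (ordered) complements $-X=S_1\setminus X$, $-Y=S_2\setminus Y$ (the same orderings are used throughout). Let $l$ be the duplicate label. In both of the following cases the columns of $E(v)$ correspond to $y_Y,y_{-Y},\pi_1$ and the rows of $E(w)$ to $\lambda,x_X,x_{-X},\pi_2$. Case $l\in X$ (so $A_ly=\pi_1$, $x_l=0$): $$E(v)=\begin{bmatrix}1_{1\times|Y|}&1_{1\times|-Y|}&0\\ A_X^Y&A_X^{-Y}&-1_{|X|\times1}\\ 0&-I_{|-Y|}&0\end{bmatrix},\quad E(w)=\begin{bmatrix}0&\beta_Y^T&0&0\\ 1_{|X|\times1}&C_X^Y&(-e_l)_X&0\\ 1_{|-X|\times1}&C_{-X}^Y&0&-I_{|-X|}\\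 0&-1_{1\times|Y|}&0&0\end{bmatrix},$$ where $-e_l$ is the negative unit vector at $x_l$. Case $l$ is the label of a column strategy in $Y$, this strategy being also denoted $l$ (so $y_l=0$ and $x^TC^l+\beta_l\lambda=\pi_2$): $$E(v)=\begin{bmatrix}1_{1\times|Y|}&1_{1\times|-Y|}&0\\ A_X^Y&A_X^{-Y}&-1_{|X|\times1}\\ (-e_l^T)_Y&0&0\\ 0&-I_{|-Y|}&0\end{bmatrix},\quad E(w)=\begin{bmatrix}0&\beta_Y^T&0\\ 1_{|X|\times1}&C_X^Y&0\\ 1_{|-X|\times1}&C_{-X}^Y&-I_{|-X|}\\ 0&-1_{1\times|Y|}&0\end{bmatrix},$$ where $(-e_l^T)_Y$ is the row vector with $-1$ in the column of $y_l$ and $0$ elsewhere. Then $s(u)=\operatorname{sign}(\det E(v)\cdot\det E(w))\in\{+1,-1\}$ (independent of the chosen orderings). Orientation $\rightarrow$: at a vertex $u=(v,w)$ with $s(u)=+1$, the edge $\mathcal E_w\times\{w\}$ is directed away from $u$ and the edge $\{v\}\times\mathcal E_v$ towards $u$; if $s(u)=-1$ the directions are reversed. (Adjacent vertices have opposite signs, so this is consistent.) Index: for a Nash equilibrium $(x,y)$ of a non-degenerate game $(A,B)$ with $A>0,B>0$, let $I=\{i\in S_1:x_i>0\}$, $J=\{j\in S_2:y_j>0\}$; the index of $(x,y)$ is $(-1)^{|I|+1}\operatorname{sign}(\det(A_I^J)\det(B_I^J))$. *)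

(* Defs.v *)
From mathcomp Require Import all_boot all_order all_algebra.

Set Implicit Arguments.
Unset Strict Implicit.
Unset Printing Implicit Defensive.

Import Order.TTheory GRing.Theory Num.Theory.
Local Open Scope ring_scope.

Section Polyhedra.
Variables (R : realFieldType) (V : vectType R).
Implicit Types (S F : V -> Prop) (z : V).

Definition aff_hull S z : Prop :=
  exists k (p : 'I_k -> V) (a : 'I_k -> R),
    [/\ forall i, S (p i), \sum_i a i = 1 & z = \sum_i a i *: p i].

(* The dimension of a non-empty set is that of its affine hull; the empty set
   has none. *)
Definition has_dim S (d : nat) : Prop :=
  exists z0 (U : {vspace V}),
    (forall z, aff_hull S z <-> z - z0 \in U) /\ \dim U = d.

(* The choice c = 0 makes S (with b = 0) and the empty set (with b = 1) faces
   of S. *)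
Definition face S F : Prop :=
  exists (c : {scalar V}) (b : R),
    (forall z, S z -> c z <= b) /\ (forall z, F z <-> S z /\ c z = b).

Definition vertex S z : Prop := face S (fun t => t = z).

Definition segment (z z' : V) : V -> Prop :=
  fun t => exists2 a : R, 0 <= a <= 1 & t = (1 - a) *: z + a *: z'.

End Polyhedra.

Section RelativeInterior.
Variables (R : realFieldType) (k : nat).

(* Interior relative to the affine hull, for the topology of the sup norm. *)
Definition relint (F : 'cV[R]_k -> Prop) (z : 'cV[R]_k) : Prop :=
  F z /\ exists2 e : R, 0 < e &
    forall t, aff_hull F t -> (forall i, `|t i 0 - z i 0| < e) -> F t.

(* S is a polyhedron of dimension D and L z is the set of numbers of the
   inequalities that are tight at z. *)
Definition nondegenerate (N : nat) (S : 'cV[R]_k -> Prop)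
    (L : 'cV[R]_k -> {set 'I_N}) (D : nat) : Prop :=
  forall F d z, face S F -> has_dim F d -> relint F z -> #|L z| = (D - d)%N.

End RelativeInterior.

Section Games.
Variables (R : realFieldType) (m n : nat).
Implicit Types (A B C : 'M[R]_(m, n)) (beta : 'cV[R]_n) (alpha : 'cV[R]_m).
Implicit Types (x : 'cV[R]_m) (y : 'cV[R]_n).

Definition prob_vec k (p : 'cV[R]_k) : Prop :=
  (forall i, 0 <= p i 0) /\ \sum_i p i 0 = 1.

Definition payoff x A y : R := (x^T *m A *m y) 0 0.

Definition nash A B x y : Prop :=
  [/\ prob_vec x, prob_vec y,
      forall x', prob_vec x' -> payoff x' A y <= payoff x A y
    & forall y', prob_vec y' -> payoff x B y' <= payoff x B y].

(* Points of R^(n+1) are (y, pi1), points of R^(m+2) are (x, lambda, pi2), and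
   points of R^(m+1) are (x, pi2).  The inequality numbers 1, ..., m + n are
   the elements of 'I_(m + n): lshift n i for a row i and rshift m j for a
   column j. *)

Definition vy (v : 'cV[R]_(n + 1)) : 'cV[R]_n := usubmx v.
Definition vpi1 (v : 'cV[R]_(n + 1)) : R := v (rshift n ord0) 0.

Definition polyP A (v : 'cV[R]_(n + 1)) : Prop :=
  [/\ forall i, (A *m vy v) i 0 - vpi1 v <= 0,
      forall j, 0 <= vy v j 0
    & \sum_j vy v j 0 = 1].

Definition labP A (v : 'cV[R]_(n + 1)) : {set 'I_(m + n)} :=
  [set k | match split k with
           | inl i => (A *m vy v) i 0 - vpi1 v == 0
           | inr j => vy v j 0 == 0
           end].

Definition wx (w : 'cV[R]_(m + 2)) : 'cV[R]_m := usubmx w.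
Definition wlambda (w : 'cV[R]_(m + 2)) : R := w (rshift m ord0) 0.
Definition wpi2 (w : 'cV[R]_(m + 2)) : R := w (rshift m ord_max) 0.

Definition polyQ' C beta (w : 'cV[R]_(m + 2)) : Prop :=
  [/\ forall i, 0 <= wx w i 0,
      forall j, ((wx w)^T *m C) 0 j + beta j 0 * wlambda w - wpi2 w <= 0
    & \sum_i wx w i 0 = 1].

Definition labQ' C beta (w : 'cV[R]_(m + 2)) : {set 'I_(m + n)} :=
  [set k | match split k with
           | inl i => wx w i 0 == 0
           | inr j =>
             ((wx w)^T *m C) 0 j + beta j 0 * wlambda w - wpi2 w == 0
           end].

Definition qx (q : 'cV[R]_(m + 1)) : 'cV[R]_m := usubmx q.
Definition qpi2 (q : 'cV[R]_(m + 1)) : R := q (rshift m ord0) 0.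

Definition polyQ B (q : 'cV[R]_(m + 1)) : Prop :=
  [/\ forall i, 0 <= qx q i 0,
      forall j, ((qx q)^T *m B) 0 j - qpi2 q <= 0
    & \sum_i qx q i 0 = 1].

Definition labQ B (q : 'cV[R]_(m + 1)) : {set 'I_(m + n)} :=
  [set k | match split k with
           | inl i => qx q i 0 == 0
           | inr j => ((qx q)^T *m B) 0 j - qpi2 q == 0
           end].

Definition nondegenerateP A : Prop := nondegenerate (polyP A) (labP A) n.
Definition nondegenerateQ' C beta : Prop :=
  nondegenerate (polyQ' C beta) (labQ' C beta) (m + 1).
Definition nondegenerateQ B : Prop := nondegenerate (polyQ B) (labQ B) m.

Definition nondegenerate_game A B : Prop :=
  nondegenerateP A /\ nondegenerateQ B.

Definition point : vectType R := ('cV[R]_(n + 1) * 'cV[R]_(m + 2))%type.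
Implicit Types (u : point) (e : point -> Prop).

Definition polyPQ' A C beta u : Prop := polyP A u.1 /\ polyQ' C beta u.2.

Definition calN A C beta u : Prop :=
  polyPQ' A C beta u /\ labP A u.1 :|: labQ' C beta u.2 = [set: 'I_(m + n)].

Definition vertexN A C beta u : Prop :=
  vertex (polyPQ' A C beta) u /\ calN A C beta u.

(* The bounded edge of calN with end vertices u and u'. *)
Definition edgeN A C beta u u' : Prop :=
  [/\ vertexN A C beta u, vertexN A C beta u',
      face (polyPQ' A C beta) (segment u u'),
      has_dim (segment u u') 1
    & forall z, segment u u' z -> calN A C beta z].

(* E_w x {w} and {v} x E_v at u = (v, w). *)
Definition edge_in_P A C beta u : point -> Prop :=
  fun z => calN A C beta (z.1, u.2) /\ z.2 = u.2.
Definition edge_in_Q' A C beta u : point -> Prop :=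
  fun z => z.1 = u.1 /\ calN A C beta (u.1, z.2).

End Games.

Section Signs.
Variables (R : realFieldType) (m n : nat).

(* Determinant of a matrix whose two dimensions are equal, but not necessarily
   convertible. *)
Definition detr p q (M : 'M[R]_(p, q)) : R := \det (conform_mx (0 : 'M_p) M).

(* M_X^Y, with X and Y listed in increasing order. *)
Definition sub_mx (X : {set 'I_m}) (Y : {set 'I_n}) (M : 'M[R]_(m, n)) :
  'M_(#|X|, #|Y|) := mxsub enum_val enum_val M.

Definition sub_col k (X : {set 'I_k}) (c : 'cV[R]_k) : 'cV_#|X| :=
  rowsub enum_val c.

Variables (A C : 'M[R]_(m, n)) (beta : 'cV[R]_n).
Variables (X : {set 'I_m}) (Y : {set 'I_n}).

Let unit_vec k (l : 'I_k) : 'cV[R]_k := delta_mx l 0.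

Definition Ev_row :=
  col_mx (row_mx (row_mx (const_mx 1 : 'rV[R]_#|Y|)
                         (const_mx 1 : 'rV_#|~: Y|)) (0 : 'M_1))
 (col_mx (row_mx (row_mx (sub_mx X Y A) (sub_mx X (~: Y) A)) (const_mx (-1)))
         (row_mx (row_mx 0 (- 1%:M : 'M_#|~: Y|)) 0)).

Definition Ew_row (l : 'I_m) :=
  col_mx (row_mx (0 : 'M[R]_1)
         (row_mx (sub_col Y beta)^T (row_mx (0 : 'M_1) 0)))
 (col_mx (row_mx (const_mx 1)
         (row_mx (sub_mx X Y C) (row_mx (sub_col X (- unit_vec l)) 0)))
 (col_mx (row_mx (const_mx 1)
         (row_mx (sub_mx (~: X) Y C) (row_mx 0 (- 1%:M : 'M_#|~: X|))))
         (row_mx (0 : 'M_1) (row_mx (const_mx (-1)) (row_mx 0 0))))).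

Definition Ev_col (l : 'I_n) :=
  col_mx (row_mx (row_mx (const_mx 1 : 'rV[R]_#|Y|)
                         (const_mx 1 : 'rV_#|~: Y|)) (0 : 'M_1))
 (col_mx (row_mx (row_mx (sub_mx X Y A) (sub_mx X (~: Y) A)) (const_mx (-1)))
 (col_mx (row_mx (row_mx (sub_col Y (- unit_vec l))^T 0) 0)
         (row_mx (row_mx 0 (- 1%:M : 'M_#|~: Y|)) 0))).

Definition Ew_col :=
  col_mx (row_mx (0 : 'M[R]_1) (row_mx (sub_col Y beta)^T 0))
 (col_mx (row_mx (const_mx 1) (row_mx (sub_mx X Y C) 0))
 (col_mx (row_mx (const_mx 1)
         (row_mx (sub_mx (~: X) Y C) (- 1%:M : 'M_#|~: X|)))
         (row_mx (0 : 'M_1) (row_mx (const_mx (-1)) 0)))).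

End Signs.

Section Orientation.
Variables (R : realFieldType) (m n : nat).
Variables (A C : 'M[R]_(m, n)) (beta : 'cV[R]_n).
Implicit Types (u : point R m n) (e : point R m n -> Prop).

Definition best_rows u : {set 'I_m} :=
  [set i | (A *m vy u.1) i 0 == vpi1 u.1].

Definition best_cols u : {set 'I_n} :=
  [set j | ((wx u.2)^T *m C) 0 j + beta j 0 * wlambda u.2 == wpi2 u.2].

(* At a vertex of calN the set of labels searched below is a singleton; it is
   split into the two cases "row" and "column" of the duplicate label.  The
   value 0 for an empty set is a dummy. *)
Definition sign u : R :=
  let X := best_rows u in
  let Y := best_cols u in
  if [pick k in labP A u.1 :&: labQ' C beta u.2] is Some k then
    match split k with
    | inl l => Num.sg (detr (Ev_row A X Y) * detr (Ew_row C beta X Y l))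
    | inr l => Num.sg (detr (Ev_col A X Y l) * detr (Ew_col C beta X Y))
    end
  else 0.

(* The edge e of calN, incident to the vertex u, is directed away from u. *)
Definition directed_away u e : Prop :=
  (sign u = 1 /\ forall z, e z <-> edge_in_P A C beta u z) \/
  (sign u = -1 /\ forall z, e z <-> edge_in_Q' A C beta u z).

(* The edge with end vertices u and u' is oriented from u to u'.  The rule at
   u' gives the same direction, because adjacent vertices of calN have opposite
   signs. *)
Definition oriented u u' : Prop := directed_away u (segment u u').

End Orientation.

Definition nash_index (R : realFieldType) (m n : nat) (A B : 'M[R]_(m, n))
    (x : 'cV[R]_m) (y : 'cV[R]_n) : R :=
  let I := [set i | 0 < x i 0] in
  let J := [set j | 0 < y j 0] in
  (-1) ^+ (#|I| + 1) * Num.sg (detr (sub_mx I J A) * detr (sub_mx I J B)).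

(* Main.v *)
Require Import Defs.
(** An edge of [calN] crossing [H] at an equilibrium moves in [Q'] only: if [w]
    stayed fixed, its [m + 1] labels would all be tight at a point of [Q],
    against non-degeneracy of the game.  Let [u = (v, w)] be the tail, [l] its
    duplicate label, [t] the point on [H], [d = t - w] and
    [h = lambda - alpha x].  Cramer's rule applied to the solution
    [(y, pi1)] of a system with matrix [E(v)] turns [pi1 det E(v)] into
    [det A_I^J] up to sign.  Multiplying [E(w)] by a matrix having [d] and [t]
    among its rows turns [h(d) pi2 det E(w)] into [det B_I^J] times the positive
    slack of [l] at [t], up to sign, because [d] and [t] annihilate all columns
    of [E(w)] except those of the sum and of [l].  The two signs combine to
    [(-1)^|I|], so the index is [- s(u) sign (h d)], where [h d = - h w] and
    [s(u) = -1]. *)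
From HB Require Import structures.
From mathcomp Require Import all_boot all_order all_algebra zify ring lra.

Set Implicit Arguments.
Unset Strict Implicit.
Unset Printing Implicit Defensive.

Import Order.TTheory GRing.Theory Num.Theory.
Local Open Scope ring_scope.

(** * Determinants of block matrices whose two dimensions are only provably equal *)

Lemma detrE (R : realFieldType) n (M : 'M[R]_n) : detr M = \det M.
Proof. by rewrite /detr conform_mx_id. Qed.

Lemma detr_castmx (R : realFieldType) p q p' q'
    (e : (p = p') * (q = q')) (M : 'M[R]_(p, q)) :
  detr (castmx e M) = detr M.
Proof.
by case: e => e1 e2; case: p' / e1; case: q' / e2; rewrite castmx_id.
Qed.

Lemma detr_mul (R : realFieldType) p q r (M : 'M[R]_(p, q)) (N : 'M[R]_(q, r)) :
  p = q -> q = r -> detr (M *m N) = detr M * detr N.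
Proof. by move=> e1 e2; subst q r; rewrite !detrE det_mulmx. Qed.

Lemma detr_ublock (R : realFieldType) p p' q q' (A : 'M[R]_(p, p'))
    (B : 'M_(p, q')) (D : 'M_(q, q')) :
  p = p' -> q = q' -> detr (block_mx A B 0 D) = detr A * detr D.
Proof. by move=> e1 e2; subst p' q'; rewrite !detrE det_ublock. Qed.

Lemma detr_lblock (R : realFieldType) p p' q q' (A : 'M[R]_(p, p'))
    (C : 'M_(q, p')) (D : 'M_(q, q')) :
  p = p' -> q = q' -> detr (block_mx A 0 C D) = detr A * detr D.
Proof. by move=> e1 e2; subst p' q'; rewrite !detrE det_lblock. Qed.

Lemma detr_col_mxA (R : realFieldType) p1 p2 p3 q (A1 : 'M[R]_(p1, q))
    (A2 : 'M_(p2, q)) (A3 : 'M_(p3, q)) :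
  detr (col_mx A1 (col_mx A2 A3)) = detr (col_mx (col_mx A1 A2) A3).
Proof. by rewrite col_mxA detr_castmx. Qed.

Lemma detr_opp1 (R : realFieldType) c : detr (- 1%:M : 'M[R]_c) = (-1) ^+ c.
Proof. by rewrite detrE -raddfN det_scalar. Qed.

(** Both determinants are expanded along [r]: the minors agree, and the cofactor signs differ by
    [(-1) ^+ p] because [r] is row [0] on one side and row [p] on the other. *)
Lemma detr_rot (R : realFieldType) p q (r : 'rV[R]_q) (B : 'M_(p, q)) :
  p.+1 = q -> detr (col_mx r B) = (-1) ^+ p * detr (col_mx B r).
Proof.
move=> e; subst q; rewrite detrE.
rewrite -(detr_castmx (addn1 p, erefl _) (col_mx B r)).
set N := castmx _ _; rewrite detrE.
have Nmax j : N ord_max j = r 0 j.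
  rewrite castmxE /= cast_ord_id.
  have -> : cast_ord (esym (addn1 p)) ord_max = rshift p ord0.
    by apply: val_inj; rewrite /= addn0.
  by rewrite col_mxEd.
have N' : row' ord_max N = B.
  apply/matrixP=> i j; rewrite mxE castmxE /= cast_ord_id.
  have -> : cast_ord (esym (addn1 p)) (lift ord_max i) = lshift 1 i.
    by apply: val_inj; rewrite /= /bump leqNgt ltn_ord.
  by rewrite col_mxEu.
have M' : row' (0 : 'I_(1 + p)) (col_mx r B) = B.
  apply/matrixP=> i j; rewrite mxE.
  have -> : lift 0 i = rshift 1 i by apply: val_inj.
  by rewrite col_mxEd.
rewrite (expand_det_row _ 0) (expand_det_row N ord_max) mulr_sumr.
apply: eq_bigr => j _; rewrite Nmax.
have -> : col_mx r B 0 j = r 0 j.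
  have -> : (0 : 'I_(1 + p)) = lshift p 0 by apply: val_inj.
  by rewrite col_mxEu.
rewrite /cofactor.
have -> : row' 0 (col' j (col_mx r B)) = col' j B.
  by rewrite -[in RHS]M'; apply/matrixP=> i k; rewrite !mxE.
have -> : row' ord_max (col' j N) = col' j B.
  by rewrite -[in RHS]N'; apply/matrixP=> i k; rewrite !mxE.
rewrite /= add0n exprD !mulrA; congr (_ * _).
by rewrite [_ ^+ p * r 0 j]mulrC -(mulrA (r 0 j)) -expr2 sqrr_sign mulr1.
Qed.

Lemma detr_single (R : realFieldType) a b (M : 'M[R]_(a, b)) (r : R)
    (p : 'I_b) :
  a.+1 = b ->
  detr (col_mx (r *: delta_mx 0 p : 'rV_b) M) = r * (-1) ^+ p * detr (col' p M).
Proof.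
move=> e; subst b; rewrite !detrE (expand_det_row _ (lshift a 0)) (bigD1 p) //=.
rewrite big1 ?addr0 => [|j jp].
  rewrite col_mxEu !mxE !eqxx mulr1 /cofactor /= add0n mulrA.
  congr (_ * \det _); apply/matrixP=> i j.
  rewrite mxE [LHS]mxE [RHS]mxE.
  have -> : lift (lshift a (0 : 'I_1)) (i : 'I_(1 + a).-1) =
      rshift 1 (i : 'I_a).
    exact: val_inj.
  by rewrite col_mxEd.
by rewrite col_mxEu !mxE (negPf jp) andbF mulr0 mul0r.
Qed.

(** * Block forms of det E(v) and det E(w) *)

(** Cramer's rule: [(y, 0, p)] solves the system whose right-hand side is [1] in the sum row and [0]
    elsewhere. Moving the sum row to the bottom costs [(-1) ^+ (a + c)] and the block [- 1%:M]
    contributes [(-1) ^+ c], so [(-1) ^+ a] remains. *)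
Lemma detr_Ev (R : realFieldType) a q c (A1 : 'M[R]_(a, q)) (A2 : 'M_(a, c))
    (pc : 'cV_a) (y : 'cV_q) (p : R) :
  a = q -> const_mx 1 *m y = 1%:M :> 'M_1 -> A1 *m y + p *: pc = 0 ->
  p * detr (col_mx (row_mx (row_mx (const_mx 1 : 'rV_q)
                                   (const_mx 1 : 'rV_c)) (0 : 'M_1))
           (col_mx (row_mx (row_mx A1 A2) pc)
                   (row_mx (row_mx 0 (- 1%:M : 'M_c)) 0)))
  = (-1) ^+ a * detr A1.
Proof.
move=> e y1 Ay; subst q.
rewrite detr_rot ?addn1 // mulrCA.
have -> : col_mx (row_mx (row_mx A1 A2) pc) (row_mx (row_mx 0 (- 1%:M)) 0) =
    row_mx (block_mx A1 A2 0 (- 1%:M)) (col_mx pc 0).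
  by rewrite -block_mxEv block_mxEh -block_mxEv.
(* Replace the last column by the product of the matrix with [(y, 0, p)]. *)
pose K : 'M_(a + c + 1) := block_mx 1%:M (col_mx y 0) 0 p%:M.
have Kp : detr K = p by rewrite detrE /K det_ublock det1 mul1r det_scalar1.
rewrite -{1}Kp [detr K * _]mulrC -detr_mul //.
rewrite -block_mxEv /K mulmx_block !mulmx1 !mulmx0 !mul0mx !addr0.
rewrite mul_row_col mul_block_col y1 !mulmx0 !mul0mx !addr0.
rewrite mul_mx_scalar scale_col_mx scaler0 add_col_mx Ay addr0 col_mx0.
rewrite detr_lblock ?addn0 // detr_ublock // detr_opp1 [detr 1%:M]detrE det1.
by rewrite mulr1 [detr A1 * _]mulrC mulrA exprD -[_ * _ * _ ^+ c]mulrA -expr2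
  sqrr_sign mulr1.
Qed.

(* [g] and [p] are [h(d)] and [pi2] at [t], [dp] is [pi2] at [d], and the row
   [dW] is the product of [d], and of [t], with the middle columns.  The matrix
   [K0] adds multiples of the [lambda] row to pass from [C] to
   [B = C + alpha beta^T], after which [h] replaces [lambda] as a coordinate;
   [K1] replaces the first row by [d] and the last one by [t]; [K2] subtracts
   the first row from the last. *)
Lemma detr_Ew (R : realFieldType) k c q (b f dW : 'rV[R]_q) (C1 : 'M_(k, q))
    (C2 : 'M_(c, q)) (a1 : 'cV[R]_k) (x dx : 'rV_k) (g p dp : R) :
  q = k.+1 ->
  x *m const_mx 1 = 1%:M :> 'M_1 -> dx *m const_mx 1 = 0 :> 'M_1 ->
  x *m (C1 + a1 *m b) + p *: f = dW ->
  g *: b + dx *m (C1 + a1 *m b) + dp *: f = dW ->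
  g * p * detr (col_mx (row_mx (0 : 'M_1) (row_mx b 0))
               (col_mx (row_mx (const_mx 1) (row_mx C1 0))
               (col_mx (row_mx (const_mx 1) (row_mx C2 (- 1%:M : 'M_c)))
                       (row_mx (0 : 'M_1) (row_mx f 0)))))
  = (-1) ^+ k.+1 * detr (col_mx dW (C1 + a1 *m b)).
Proof.
move=> eq x1 dx1 xW dxW; set B1 := C1 + a1 *m b; set N := col_mx _ _.
pose K0 : 'M[R]_(1 + (k + (c + 1))) :=
  block_mx 1%:M 0 (col_mx a1 0) 1%:M.
pose K1 : 'M[R]_(1 + (k + (c + 1))) :=
  block_mx g%:M (row_mx dx (row_mx 0 dp%:M)) 0
    (block_mx 1%:M 0 (col_mx 0 x) (block_mx 1%:M 0 0 p%:M)).
pose K2 : 'M[R]_(1 + (k + (c + 1))) :=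
  block_mx 1%:M 0 (col_mx 0 (col_mx 0 (- 1%:M))) 1%:M.
have K0N : K0 *m N = col_mx (row_mx 0 (row_mx b 0))
    (col_mx (row_mx (const_mx 1) (row_mx B1 0))
    (col_mx (row_mx (const_mx 1) (row_mx C2 (- 1%:M)))
            (row_mx 0 (row_mx f 0)))).
  rewrite /K0 /N mul_block_col !mul1mx mul0mx addr0 !mul_col_mx !mul_mx_row.
  rewrite !mulmx0 !mul0mx !add_col_mx !add_row_mx !add0r.
  by rewrite !row_mx0 add0r /B1 (addrC C1).
have K1N : K1 *m (K0 *m N) = col_mx (row_mx 0 (row_mx dW 0))
    (col_mx (row_mx (const_mx 1) (row_mx B1 0))
    (col_mx (row_mx (const_mx 1) (row_mx C2 (- 1%:M)))
            (row_mx 1%:M (row_mx dW 0)))).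
  rewrite K0N /K1 mul_block_col mul0mx add0r; congr col_mx.
    rewrite mul_row_col mul_row_col !mul_mx_row !mulmx0 !mul0mx !add_row_mx.
    by rewrite dx1 !addr0 !add0r !mul_scalar_mx addrA dxW.
  rewrite mul_block_col mul1mx mul0mx addr0; congr col_mx.
  rewrite mul_col_mx mul_block_col !mul0mx !mul1mx addr0 add0r add_col_mx add0r.
  congr col_mx; rewrite !mul_mx_row !add_row_mx !mulmx0 !addr0 x1.
  by rewrite mul_scalar_mx xW.
have K2N : K2 *m (K1 *m (K0 *m N)) = col_mx (row_mx 0 (row_mx dW 0))
    (col_mx (row_mx (const_mx 1) (row_mx B1 0))
    (col_mx (row_mx (const_mx 1) (row_mx C2 (- 1%:M)))
            (row_mx 1%:M (row_mx 0 0)))).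
  rewrite K1N /K2 mul_block_col !mul1mx mul0mx addr0 !mul_col_mx !mul0mx.
  rewrite !add_col_mx !add0r mulNmx mul1mx !opp_row_mx !add_row_mx.
  by rewrite !oppr0 !add0r addNr.
have dimN : (1 + (k + (c + 1)) = 1 + (q + c))%N.
  by rewrite eq addn1 addnS addSn.
have -> : g * p * detr N = detr (K2 *m (K1 *m (K0 *m N))).
  have K0d : detr K0 = 1 by rewrite detr_lblock // !detrE !det1 mulr1.
  have K2d : detr K2 = 1 by rewrite detr_lblock // !detrE !det1 mulr1.
  have K1d : detr K1 = g * p.
    by rewrite detr_ublock // !detr_lblock // !detrE !det1 !det_scalar1 !mul1r.
  by rewrite !detr_mul // K0d K1d K2d !mul1r.
rewrite K2N !detr_col_mxA.
(* The last row [r] is now [(1, 0, 0)]. Moved to the top, it splits off the first column; the factor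
   [(-1) ^+ c] of this move cancels against the block [- 1%:M]. *)
set B := (X in detr (col_mx X _)); set r := (X in col_mx B X).
have -> : detr (col_mx B r) = (-1) ^+ (1 + k + c) * detr (col_mx r B).
  by rewrite detr_rot ?mulrA -?expr2 ?sqrr_sign ?mul1r // eq.
have -> : B = row_mx (col_mx (col_mx 0 (const_mx 1)) (const_mx 1))
                     (block_mx (col_mx dW B1) 0 C2 (- 1%:M)).
  rewrite /B -block_mxEv block_mxEh -block_mxEv block_mxEh; congr row_mx.
  by rewrite -block_mxEv block_mxEh col_mx0 -block_mxEv.
rewrite /r row_mx0 -/(block_mx _ _ _ _) detr_lblock ?detr_lblock ?eq //.
rewrite detr_opp1 detrE det1 mul1r exprD [detr _ * _]mulrC mulrA.
by rewrite -[_ * _ * _ ^+ c]mulrA -expr2 sqrr_sign mulr1.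
Qed.

(** * Submatrices indexed by sets of strategies *)

(** Both enumerations follow that of [T], so the smaller set is listed by deleting position [p] from
    the list of [Y], and [lift p] skips exactly this position. *)
Lemma enum_val_setD1 (T : finType) (Y : {set T}) (p : 'I_#|Y|)
    (e : #|Y :\ enum_val p| = #|Y|.-1) (j : 'I_#|Y :\ enum_val p|) :
  enum_val j = enum_val (lift p (cast_ord e j)).
Proof.
set l := enum_val p.
have x0 : T := l.
have szp : (p < size (enum Y))%N by rewrite -cardE.
have lE : nth x0 (enum Y) p = l by rewrite /l (enum_val_nth x0).
have enumD1 : enum (Y :\ l) = rem l (enum Y).
  rewrite rem_filter ?enum_uniq // /enum_mem -filter_predI.
  by apply: eq_filter => i /=; rewrite !inE.
have -> : enum_val j = nth x0 (enum (Y :\ l)) j by exact: enum_val_nth.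
have -> : enum_val (lift p (cast_ord e j)) = nth x0 (enum Y) (bump p j).
  exact: enum_val_nth.
rewrite enumD1 remE -lE index_uniq ?enum_uniq // nth_cat size_take szp.
rewrite /bump; case: (ltnP j p) => jp /=.
  by rewrite nth_take.
by rewrite nth_drop addSn subnKC.
Qed.

Lemma detr_sub_setD1 (R : realFieldType) m n (X : {set 'I_m}) (Y : {set 'I_n})
    (p : 'I_#|Y|) (M : 'M[R]_(m, n)) :
  detr (sub_mx X (Y :\ enum_val p) M) = detr (col' p (sub_mx X Y M)).
Proof.
have e : #|Y :\ enum_val p| = #|Y|.-1.
  by rewrite (cardsD1 (enum_val p) Y) enum_valP.
rewrite -(detr_castmx (erefl, e)); congr detr; apply/matrixP => i j.
rewrite castmxE !mxE /= cast_ord_id (enum_val_setD1 e).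
by congr (M _ (enum_val (lift p _))); apply: val_inj.
Qed.

(** Inner indices outside [Y] contribute only zeros. Identities for full strategy vectors thereby
    pass to submatrices indexed by sets that contain their supports. *)
Lemma mul_supp (R : realFieldType) a m b (Y : {set 'I_m}) (M : 'M[R]_(a, m))
    (N : 'M[R]_(m, b)) :
  (forall i j k, j \notin Y -> M i j * N j k = 0) ->
  colsub enum_val M *m rowsub (@enum_val _ (mem Y)) N = M *m N.
Proof.
move=> MN0; apply/matrixP => i k; rewrite !mxE [RHS](bigID (mem Y)) /=.
rewrite [X in _ + X]big1 ?addr0 => [|j /MN0 //].
by rewrite [RHS]big_enum_val; apply: eq_bigr => j _; rewrite !mxE.
Qed.

(** Merges the extra block row of [Ev_col], as [row_mxAr] merges the extra block column of [Ew_row],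
    to reach the shapes of [detr_Ev] and [detr_Ew]. *)
Lemma detr_col_mxAr (R : realFieldType) p0 p1 p2 p3 q (A0 : 'M[R]_(p0, q))
    (A1 : 'M_(p1, q)) (A2 : 'M_(p2, q)) (A3 : 'M_(p3, q)) :
  detr (col_mx A0 (col_mx A1 (col_mx A2 A3))) =
  detr (col_mx A0 (col_mx (col_mx A1 A2) A3)).
Proof. by rewrite [col_mx A1 _]col_mxA /=; case: _ / (esym _). Qed.

Lemma row_mxAr (R : realFieldType) p q0 q1 q2 q3 (A0 : 'M[R]_(p, q0))
    (A1 : 'M_(p, q1)) (A2 : 'M_(p, q2)) (A3 : 'M_(p, q3)) :
  row_mx A0 (row_mx A1 (row_mx A2 A3)) =
  castmx (erefl, congr1 (addn q0) (esym (addnA q1 q2 q3)))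
    (row_mx A0 (row_mx (row_mx A1 A2) A3)).
Proof. by rewrite [row_mx A1 _]row_mxA /=; case: _ / (esym _). Qed.

Lemma const1_mul (R : realFieldType) n (y : 'cV[R]_n) :
  const_mx 1 *m y = (\sum_j y j 0)%:M :> 'M_1.
Proof.
apply/matrixP=> i j; rewrite !ord1 !mxE mulr1n.
by apply: eq_bigr => k _; rewrite mxE mul1r.
Qed.

Lemma sub_const1 (R : realFieldType) n (Y : {set 'I_n}) (y : 'cV[R]_n) :
  \sum_j y j 0 = 1 -> (forall j, j \notin Y -> y j 0 = 0) ->
  const_mx 1 *m sub_col Y y = 1%:M :> 'M_1.
Proof.
move=> y1 y0.
have -> : const_mx 1 = colsub (@enum_val _ (mem Y)) (const_mx 1 : 'rV[R]_n).
  by apply/matrixP=> i j; rewrite !mxE.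
rewrite mul_supp ?const1_mul ?y1 // => i j k /y0 yj0.
by rewrite (ord1 k) yj0 mulr0.
Qed.

Lemma sub_mx_mul (R : realFieldType) m n (A : 'M[R]_(m, n)) (X : {set 'I_m})
    (Y : {set 'I_n}) (y : 'cV_n) :
  (forall j, j \notin Y -> y j 0 = 0) ->
  sub_mx X Y A *m sub_col Y y = sub_col X (A *m y).
Proof.
move=> y0.
have -> : sub_mx X Y A = colsub (@enum_val _ (mem Y)) (rowsub enum_val A).
  by apply/matrixP=> i j; rewrite !mxE.
rewrite mul_supp => [|i j k /y0 yj0]; last by rewrite (ord1 k) yj0 mulr0.
by rewrite mul_rowsub_mx.
Qed.

(** * det E(v) and det E(w) in terms of submatrices of the payoff matrices *)

Lemma detr_Ev_row (R : realFieldType) m n (A : 'M[R]_(m, n)) (X : {set 'I_m})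
    (Y : {set 'I_n}) (y : 'cV_n) (p : R) :
  #|X| = #|Y| -> \sum_j y j 0 = 1 -> (forall j, j \notin Y -> y j 0 = 0) ->
  (forall i, i \in X -> (A *m y) i 0 = p) ->
  p * detr (Ev_row A X Y) = (-1) ^+ #|X| * detr (sub_mx X Y A).
Proof.
move=> eXY y1 y0 Ay; apply: (@detr_Ev _ _ _ _ _ _ _ (sub_col Y y)) => //.
  exact: sub_const1.
rewrite sub_mx_mul //; apply/matrixP=> i j.
by rewrite !ord1 [LHS]mxE mxE Ay ?enum_valP // !mxE mulrN1 subrr.
Qed.

(** The row [-e_l] is appended to [A_X^Y]; it is satisfied by [y] because [y_l = 0]. Expanding along
    it deletes column [l], and the row move and the entry [-1] cancel all signs but [(-1) ^+ l]. *)
Lemma detr_Ev_col (R : realFieldType) m n (A : 'M[R]_(m, n)) (X : {set 'I_m})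
    (Y : {set 'I_n}) (y : 'cV_n) (p : R) (l : 'I_#|Y|) :
  #|X|.+1 = #|Y| -> \sum_j y j 0 = 1 -> (forall j, j \notin Y -> y j 0 = 0) ->
  (forall i, i \in X -> (A *m y) i 0 = p) -> y (enum_val l) 0 = 0 ->
  p * detr (Ev_col A X Y (enum_val l)) =
  (-1) ^+ l * detr (sub_mx X (Y :\ enum_val l) A).
Proof.
move=> eXY y1 y0 Ay yl0;
rewrite /Ev_col detr_col_mxAr.
have -> : col_mx
    (row_mx (row_mx (sub_mx X Y A) (sub_mx X (~: Y) A)) (const_mx (-1)))
    (row_mx (row_mx (sub_col Y (- delta_mx (enum_val l) 0))^T 0) 0) =
  row_mx (row_mx (col_mx (sub_mx X Y A) (- delta_mx 0 l))
                 (col_mx (sub_mx X (~: Y) A) 0))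
         (col_mx (const_mx (-1)) (0 : 'M_1)).
  rewrite -block_mxEv block_mxEh -block_mxEv block_mxEh.
  congr (row_mx (row_mx (col_mx _ _) _) _).
  apply/matrixP=> i j; rewrite !mxE (inj_eq enum_val_inj) ord1 andbT.
  by rewrite eqxx andTb.
rewrite (@detr_Ev _ _ _ _ _ _ _ (sub_col Y y)) ?addn1 //.
- have -> : - delta_mx 0 l = (- 1) *: delta_mx 0 l :> 'rV[R]_#|Y|.
    by rewrite scaleN1r.
  have := @detr_rot R #|X| #|Y| ((- 1) *: delta_mx 0 l) (sub_mx X Y A) eXY.
  move/(congr1 ( *%R ((-1) ^+ #|X|))); rewrite mulrA -expr2 sqrr_sign mul1r.
  rewrite exprD expr1 mulrAC => <-; rewrite detr_single // detr_sub_setD1.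
  by rewrite !mulrA -expr2 sqrr_sign mul1r mulN1r mulrN1 mulNr opprK.
- exact: (sub_const1 y1 y0).
- rewrite mul_col_mx scale_col_mx add_col_mx (sub_mx_mul _ _ y0) scaler0 addr0.
  rewrite mulNmx -rowE -(@col_mx0 _ #|X| 1 1); congr col_mx.
    apply/matrixP=> i j; rewrite !ord1 [LHS]mxE mxE Ay ?enum_valP //.
    by rewrite !mxE mulrN1 subrr.
  by apply/matrixP=> i j; rewrite !mxE ord1 yl0 oppr0.
Qed.

Lemma sub_colT_mul (R : realFieldType) m q (X : {set 'I_m}) (x : 'cV[R]_m)
    (N : 'M_(m, q)) :
  (forall i, i \notin X -> x i 0 = 0) ->
  (sub_col X x)^T *m rowsub (@enum_val _ (mem X)) N = x^T *m N.
Proof.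
move=> x0; rewrite /sub_col trmx_mxsub mul_supp // => i j k /x0 xj0.
by rewrite mxE (ord1 i) xj0 mul0r.
Qed.

Lemma sub_colT_const1 (R : realFieldType) m (X : {set 'I_m}) (x : 'cV[R]_m) s :
  \sum_i x i 0 = s -> (forall i, i \notin X -> x i 0 = 0) ->
  (sub_col X x)^T *m const_mx 1 = s%:M :> 'M_1.
Proof.
move=> x1 x0.
have -> : const_mx 1 = rowsub (@enum_val _ (mem X)) (const_mx 1 : 'cV[R]_m).
  by apply/matrixP=> i j; rewrite !mxE.
rewrite sub_colT_mul // -[RHS]trmxK tr_scalar_mx -x1 -const1_mul trmx_mul.
by rewrite trmx_const.
Qed.

(** The sum is the value of [lambda] on H, so there the column inequalities of Q' are those of Q for
    the matrix [C + alpha *m beta^T]. *)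
Lemma row_mul_addE (R : realFieldType) m n (C : 'M[R]_(m, n)) (beta : 'cV_n)
    (alpha x : 'cV_m) j :
  (x^T *m (C + alpha *m beta^T)) 0 j =
  (x^T *m C) 0 j + beta j 0 * \sum_i alpha i 0 * x i 0.
Proof.
rewrite mulmxDr mulmxA mxE; congr (_ + _).
rewrite mxE big_ord1 [_^T _ _]mxE mulrC mxE; congr (_ * _).
by apply: eq_bigr => i _; rewrite mxE mulrC.
Qed.

(** The slack of column [j] is linear in the point; with [lambda] written as [h + alpha x] it
    becomes [h beta_j + x^T B^j - pi2]. The left side is this form at the difference of the two
    points, where [h] is minus its value at the second point, since the first lies on H. *)
Lemma slackB (R : realFieldType) m n (C : 'M[R]_(m, n)) (beta : 'cV_n)
    (alpha x x0 : 'cV_m) (la la0 p p0 : R) j :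
  la = \sum_i alpha i 0 * x i 0 ->
  - (la0 - \sum_i alpha i 0 * x0 i 0) * beta j 0 +
    ((x - x0)^T *m (C + alpha *m beta^T)) 0 j - (p - p0) =
  ((x^T *m C) 0 j + beta j 0 * la - p) -
  ((x0^T *m C) 0 j + beta j 0 * la0 - p0).
Proof.
move=> ->; have -> : (x - x0)^T = x^T - x0^T by rewrite linearB.
have subE (N N' : 'rV[R]_n) : (N - N') 0 j = N 0 j - N' 0 j by rewrite !mxE.
by rewrite mulmxBl subE !row_mul_addE; ring.
Qed.

(** The second point is tight on all of [Y], the first on all of [Y] but [l]. So the first point and
    the difference of the two both give the row [- r e_l] in [detr_Ew], and expanding along it
    deletes column [l]. *)
Lemma detr_Ew_col (R : realFieldType) m n (C : 'M[R]_(m, n)) (beta : 'cV_n)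
    (alpha : 'cV_m) (X : {set 'I_m}) (Y : {set 'I_n}) (l : 'I_#|Y|)
    (x x0 : 'cV_m) (la la0 p p0 r : R) :
  #|X|.+1 = #|Y| -> \sum_i x i 0 = 1 -> \sum_i x0 i 0 = 1 ->
  (forall i, i \notin X -> x i 0 = 0) -> (forall i, i \notin X -> x0 i 0 = 0) ->
  (forall j, j \in Y -> (x^T *m C) 0 j + beta j 0 * la - p =
     if j == enum_val l then - r else 0) ->
  (forall j, j \in Y -> (x0^T *m C) 0 j + beta j 0 * la0 - p0 = 0) ->
  la = \sum_i alpha i 0 * x i 0 ->
  - (la0 - \sum_i alpha i 0 * x0 i 0) * p * detr (Ew_col C beta X Y) =
  (-1) ^+ #|X| * (-1) ^+ l * r *
  detr (sub_mx X (Y :\ enum_val l) (C + alpha *m beta^T)).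
Proof.
move=> eXY x1 x01 xX x0X tY t0Y laE.
have BE : sub_mx X Y C + sub_col X alpha *m (sub_col Y beta)^T =
    rowsub enum_val (colsub enum_val (C + alpha *m beta^T)).
  by apply/matrixP=> i j; rewrite !mxE !big_ord1 !mxE.
have dx0 i : i \notin X -> (x - x0) i 0 = 0.
  by move=> iX; rewrite !mxE xX ?x0X ?subr0.
rewrite (@detr_Ew _ _ _ _ _ _ ((- r) *: delta_mx 0 l) _ _ (sub_col X alpha)
  (sub_col X x)^T (sub_col X (x - x0))^T _ _ (p - p0)) //.
- rewrite detr_single // exprS BE detr_sub_setD1.
  have -> : sub_mx X Y (C + alpha *m beta^T) =
      rowsub enum_val (colsub enum_val (C + alpha *m beta^T)).
    by apply/matrixP=> i j; rewrite !mxE.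
  by ring.
- by apply: sub_colT_const1.
- rewrite (@sub_colT_const1 _ _ _ _ 0) //; first by rewrite raddf0.
  by under eq_bigr do rewrite !mxE; rewrite sumrB x1 x01 subrr.
- rewrite BE sub_colT_mul //; apply/matrixP=> i j.
  rewrite (ord1 i) mulmx_colsub; have := tY _ (enum_valP j).
  rewrite (inj_eq enum_val_inj) laE -row_mul_addE => tj.
  rewrite !mxE in tj *; rewrite mulrN1 {}tj eqxx /=.
  by case: (j == l); rewrite ?mulr1 ?mulr0.
- rewrite BE sub_colT_mul //; apply/matrixP=> i j.
  rewrite (ord1 i) mulmx_colsub.
  have := tY _ (enum_valP j); have := t0Y _ (enum_valP j).
  rewrite (inj_eq enum_val_inj).
  have -> : ((- r) *: delta_mx 0 l : 'rV[R]_#|Y|) 0 j =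
      if j == l then - r else 0.
    by rewrite !mxE; case: (j == l); rewrite ?mulr1 ?mulr0.
  move=> t0j tj.
  have := slackB C beta x0 la0 p p0 (enum_val j) laE.
  rewrite tj t0j subr0 => <-.
  by rewrite !mxE mulrN1.
Qed.

(** Here the middle columns are those of [Y] and the extra column [-e_l]. The first point and the
    difference both vanish on [Y] and, as [x0_l = 0], both give [- x_l] on the extra column. Moved
    to the bottom, this row makes the matrix block triangular. *)
Lemma detr_Ew_row (R : realFieldType) m n (C : 'M[R]_(m, n)) (beta : 'cV_n)
    (alpha : 'cV_m) (X : {set 'I_m}) (Y : {set 'I_n}) (l : 'I_m)
    (x x0 : 'cV_m) (la la0 p p0 : R) :
  #|X| = #|Y| -> \sum_i x i 0 = 1 -> \sum_i x0 i 0 = 1 ->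
  (forall i, i \notin X -> x i 0 = 0) -> (forall i, i \notin X -> x0 i 0 = 0) ->
  (forall j, j \in Y -> (x^T *m C) 0 j + beta j 0 * la - p = 0) ->
  (forall j, j \in Y -> (x0^T *m C) 0 j + beta j 0 * la0 - p0 = 0) ->
  x0 l 0 = 0 -> la = \sum_i alpha i 0 * x i 0 ->
  - (la0 - \sum_i alpha i 0 * x0 i 0) * p * detr (Ew_row C beta X Y l) =
  x l 0 * detr (sub_mx X Y (C + alpha *m beta^T)).
Proof.
move=> eXY x1 x01 xX x0X tY t0Y x0l laE.
have BE : sub_mx X Y C + sub_col X alpha *m (sub_col Y beta)^T =
    sub_mx X Y (C + alpha *m beta^T).
  by apply/matrixP=> i j; rewrite !mxE !big_ord1 !mxE.
have BE' : sub_mx X Y (C + alpha *m beta^T) =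
    rowsub enum_val (colsub enum_val (C + alpha *m beta^T)).
  by apply/matrixP=> i j; rewrite !mxE.
have dx0 i : i \notin X -> (x - x0) i 0 = 0.
  by move=> iX; rewrite !mxE xX ?x0X ?subr0.
have B1E : row_mx (sub_mx X Y C) (sub_col X (- delta_mx l 0)) +
    sub_col X alpha *m row_mx (sub_col Y beta)^T 0 =
    row_mx (sub_mx X Y (C + alpha *m beta^T)) (sub_col X (- delta_mx l 0)).
  by rewrite mul_mx_row mulmx0 add_row_mx BE addr0.
have el (z : 'cV[R]_m) : (forall i, i \notin X -> z i 0 = 0) ->
    (sub_col X z)^T *m sub_col X (- delta_mx l 0) = (- z l 0)%:M :> 'M_1.
  move=> z0; rewrite sub_colT_mul // mulmxN -colE.
  by apply/matrixP=> i j; rewrite !mxE !ord1 mulr1n.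
rewrite /Ew_row !row_mxAr -!cast_col_mx detr_castmx.
rewrite (@detr_Ew _ _ _ _ _ _ (row_mx 0 (- x l 0)%:M) _ _ (sub_col X alpha)
  (sub_col X x)^T (sub_col X (x - x0))^T _ _ (p - p0)) ?addn1 ?eXY //.
- rewrite B1E detr_rot ?addn1 ?eXY // -block_mxEv detr_ublock //.
  rewrite [detr _%:M]detrE.
  rewrite det_scalar1 exprS mulrA -[_ * _ * _ ^+ _]mulrA -expr2 sqrr_sign.
  by rewrite mulr1 mulN1r mulrN opprK mulrC.
- by apply: sub_colT_const1.
- rewrite (@sub_colT_const1 _ _ _ _ 0) //; first by rewrite raddf0.
  by under eq_bigr do rewrite !mxE; rewrite sumrB x1 x01 subrr.
- rewrite B1E mul_mx_row el // scale_row_mx scaler0 add_row_mx addr0.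
  congr row_mx; rewrite BE' sub_colT_mul //; apply/matrixP=> i j.
  rewrite (ord1 i) mulmx_colsub; have := tY _ (enum_valP j).
  by rewrite laE -row_mul_addE !mxE mulrN1.
- rewrite B1E mul_mx_row el // !scale_row_mx !scaler0 !add_row_mx addr0 add0r.
  congr row_mx; last by rewrite !mxE x0l subr0.
  rewrite BE' sub_colT_mul //; apply/matrixP=> i j.
  rewrite (ord1 i) mulmx_colsub.
  have := tY _ (enum_valP j); have := t0Y _ (enum_valP j).
  move=> t0j tj.
  have := slackB C beta x0 la0 p p0 (enum_val j) laE; rewrite tj t0j subr0.
  by rewrite !mxE mulrN1.
Qed.


(** * Faces, vertices and the number of tight inequalities *)

Lemma scalar_exists (R : realFieldType) (V : vectType R) (f : V -> R) :
  (forall a z t, f (a *: z + t) = a * f z + f t) ->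
  exists c : {scalar V}, forall z, c z = f z.
Proof.
move=> fL.
by exists (HB.pack_for {scalar V} f (GRing.isLinear.Build R V R *%R f fL)).
Qed.

Lemma aff_hull1 (R : realFieldType) (V : vectType R) (z t : V) :
  aff_hull (fun z' => z' = z) t <-> t = z.
Proof.
split=> [[k [p [a [pz a1 ->]]]]|->].
  by under eq_bigr do rewrite pz; rewrite -scaler_suml a1 scale1r.
exists 1%N, (fun=> z), (fun=> 1); split=> //; first by rewrite big_ord1.
by rewrite big_ord1 scale1r.
Qed.

(** A vertex is a face of dimension [0] that is its own relative interior. *)
Lemma card_vertex (R : realFieldType) k N (S : 'cV[R]_k -> Prop)
    (L : 'cV[R]_k -> {set 'I_N}) D z :
  Defs.nondegenerate S L D -> vertex S z -> #|L z| = D.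
Proof.
move=> nd vz; rewrite -[D]subn0; apply: nd vz _ _.
  exists z, 0%VS; split=> [t|]; last exact: dimv0.
  by rewrite aff_hull1 memv0 subr_eq0; split=> [->|/eqP].
by split=> //; exists 1 => // t /aff_hull1.
Qed.

(** Fixing one component of [u] in the functional that exposes [u] leaves a functional that exposes
    the other component. *)
Lemma vertex_prod (R : realFieldType) (V1 V2 : vectType R) (S1 : V1 -> Prop)
    (S2 : V2 -> Prop) (u : V1 * V2) :
  vertex (fun t : (V1 * V2)%type => S1 t.1 /\ S2 t.2) u ->
  vertex S1 u.1 /\ vertex S2 u.2.
Proof.
case: u => v w [c [b [cb cu]]]; have [[/= Sv Sw] cvw] := (cu (v, w)).1 erefl.
have cE v' w' : c (v', w') = c (v', 0) + c (0, w').
  by rewrite -raddfD; congr (c (_, _)); rewrite /= ?addr0 ?add0r.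
split.
- have [|c1 c1E] := @scalar_exists _ V1 (fun v' => c (v', 0)).
    move=> a z t; rewrite -linearP; congr (c (_, _)).
    by rewrite /= scaler0 addr0.
  exists c1, (b - c (0, w)); split=> [v' Sv'|v'].
    by rewrite c1E lerBrDr -cE; apply: cb.
  rewrite c1E; split=> [->|[Sv' /eqP]]; first by rewrite -cvw cE addrK.
  rewrite eq_sym subr_eq -cE => /eqP cb'.
  by have [] : (v', w) = (v, w) by apply/cu.
- have [|c2 c2E] := @scalar_exists _ V2 (fun w' => c (0, w')).
    move=> a z t; rewrite -linearP; congr (c (_, _)).
    by rewrite /= scaler0 addr0.
  exists c2, (b - c (v, 0)); split=> [w' Sw'|w'].
    by rewrite c2E lerBrDr addrC -cE; apply: cb.
  rewrite c2E; split=> [->|[Sw' /eqP]]; first by rewrite -cvw cE addrC addKr.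
  rewrite eq_sym subr_eq addrC -cE => /eqP cb'.
  by have [] : (v, w') = (v, w) by apply/cu.
Qed.

(* The points at which the labels of [q] are tight form a face with [q] in its
   relative interior. *)
Lemma card_tight_le (R : realFieldType) k N D (G : 'M[R]_(N, k)) (s : 'rV[R]_k)
    (S : 'cV[R]_k -> Prop) (L : 'cV[R]_k -> {set 'I_N}) :
  (forall z, S z <-> (forall i, (G *m z) i 0 <= 0) /\ (s *m z) 0 0 = 1) ->
  (forall z i, (i \in L z) = ((G *m z) i 0 == 0)) ->
  Defs.nondegenerate S L D -> forall q, S q -> (#|L q| <= D)%N.
Proof.
move=> SE LE nd q Sq; have [Gq sq] := (SE q).1 Sq.
(* Rows that are not tight at [q] are replaced by zero, so the kernel [U] holds the directions that
   preserve the tight equations and the normalization; it will be the direction space of the affine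
   hull of [F]. *)
pose T : 'M[R]_(N + 1, k) := col_mx (\matrix_(i, j) (G i j *+ (i \in L q))) s.
pose U := lker (linfun (mulmx T : 'cV_k -> 'cV_(N + 1))).
pose F z := S z /\ forall i, i \in L q -> (G *m z) i 0 = 0.
have UP d : d \in U <->
    (forall i, i \in L q -> (G *m d) i 0 = 0) /\ (s *m d) 0 0 = 0.
  have TdE i : (\matrix_(i, j) (G i j *+ (i \in L q)) *m d) i 0 =
      (G *m d) i 0 *+ (i \in L q).
    rewrite !mxE -sumrMnl; apply: eq_bigr => j _.
    by rewrite mxE mulrnAl.
  rewrite memv_ker lfunE /= mul_col_mx; split=> [/eqP/matrixP Td|[Gd sd]].
    split=> [i iL|].
      have := Td (lshift 1 i) 0; rewrite col_mxEu TdE iL mulr1n => ->.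
      by rewrite mxE.
    by have := Td (rshift N 0) 0; rewrite col_mxEd => ->; rewrite mxE.
  apply/eqP/matrixP => i j; rewrite (ord1 j) [RHS]mxE.
  case: (split_ordP i) => i' ->; last by rewrite col_mxEd (ord1 i').
  rewrite col_mxEu TdE.
  by case: (boolP (i' \in L q)) => [/Gd ->|]; rewrite ?mul0rn.
have mxB n (M M' : 'cV[R]_n) i : (M - M') i 0 = M i 0 - M' i 0 by rewrite !mxE.
have mxD n (M M' : 'cV[R]_n) i : (M + M') i 0 = M i 0 + M' i 0 by rewrite mxE.
have Fhull z : aff_hull F z -> z - q \in U.
  case=> r [p [a [Fp a1 ->]]].
  have -> : q = \sum_i a i *: q by rewrite -scaler_suml a1 scale1r.
  rewrite -sumrB memv_suml // => i _; rewrite -scalerBr memvZ //.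
  have [/SE[_ sp] Gp] := Fp i; apply/UP; split=> [j jL|].
    by move: (jL); rewrite mulmxBr mxB Gp // LE => /eqP ->; rewrite subrr.
  by rewrite mulmxBr mxB sp sq subrr.
have [e e_gt0 eF] : exists2 e : R, 0 < e &
    forall t, t - q \in U -> (forall j, `|t j 0 - q j 0| < e) -> F t.
  (* Row [i] changes by at most [M i] per unit of sup norm and has slack [sl i] at [q], so steps
     below [K^-1] preserve the inequalities that are not tight. Tight rows add [M i / 0 = 0] to [K],
     and the summand [1] keeps [K] positive. *)
  pose M i := \sum_j `|G i j|; pose sl i := - (G *m q) i 0.
  have M0 i : 0 <= M i by apply: sumr_ge0.
  have sl0 i : 0 <= sl i by rewrite oppr_ge0.
  pose K := 1 + \sum_i M i / sl i.
  have K_gt0 : 0 < K.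
    by rewrite ltr_wpDr // sumr_ge0 // => i _; rewrite divr_ge0.
  exists K^-1; rewrite ?invr_gt0 // => t /UP[Gt st] tq.
  have subE : G *m t = G *m q + G *m (t - q) by rewrite -mulmxDr addrC subrK.
  split=> [|i iL]; last by rewrite subE mxD Gt // addr0; apply/eqP; rewrite -LE.
  apply/SE; split=> [i|]; last first.
    by apply/eqP; rewrite -subr_eq0 -[X in _ - X]sq -st mulmxBr mxB.
  have [iL|iL] := boolP (i \in L q).
    by rewrite subE mxD Gt // addr0 Gq.
  have sli : 0 < sl i by rewrite lt0r sl0 oppr_eq0 -LE iL.
  have Md : (G *m (t - q)) i 0 <= M i / K.
    rewrite mxE /M mulr_suml ler_sum // => j _.
    rewrite (le_trans (ler_norm _)) // normrM ler_wpM2l //.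
    by rewrite !mxE ltW.
  have MK : M i / sl i <= K.
    rewrite /K (bigD1 i) //= addrCA lerDl addr_ge0 // sumr_ge0 // => j _.
    by rewrite divr_ge0.
  rewrite subE mxD -lerBrDl sub0r (le_trans Md) // ler_pdivrMr //.
  by rewrite -/(sl i) mulrC -ler_pdivrMr.
have Fq : F q by split=> // i; rewrite LE => /eqP.
apply: leq_trans (leq_subr (\dim U) D); rewrite (nd F (\dim U)) //.
(* The sum of the tight rows exposes [F]: it is at most [0] on [S], and vanishes only if each of its
   terms does. *)
- have [|c cE] := @scalar_exists _ _
    (fun z : 'cV[R]_k => \sum_(i in L q) (G *m z) i 0).
    move=> a z t; rewrite mulr_sumr -big_split; apply: eq_bigr => i _ /=.
    by rewrite mulmxDr mxD -scalemxAr mxE.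
  exists c, 0; split=> [z /SE[Gz _]|z]; first by rewrite cE sumr_le0.
  rewrite cE; split=> [[Sz Gz]|[Sz /eqP Gz]]; first by rewrite big1.
  split=> // i iL; have [Gz0 _] := (SE z).1 Sz; apply/eqP; rewrite -oppr_eq0.
  move: Gz; rewrite -oppr_eq0 -sumrN psumr_eq0 => [/allP /(_ i)|j _].
    by rewrite mem_index_enum iL => /(_ isT).
  by rewrite oppr_ge0.
- exists q, U; split=> // z; split=> [/Fhull //|zU].
  (* The factor [a] keeps [q + a *: (z - q)] within [e] of [q], hence in [F]; [z] is an affine
     combination of [q] and this point, with coefficients [1 - a^-1] and [a^-1]. *)
  pose K := 1 + \sum_j `|(z - q) j 0|; pose a := e / K.
  have K_gt0 : 0 < K by rewrite ltr_wpDr // sumr_ge0.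
  have a_gt0 : 0 < a by rewrite divr_gt0.
  have Fz : F (q + a *: (z - q)).
    have qE : q + a *: (z - q) - q = a *: (z - q) by rewrite addrAC subrr add0r.
    apply: eF => [|j]; first by rewrite qE memvZ.
    rewrite -mxB qE mxE normrM gtr0_norm // /a mulrAC ltr_pdivrMr //.
    rewrite ltr_pM2l // /K (bigD1 j) //= addrCA ltrDl ltr_wpDr // sumr_ge0 //.
  exists 2%N, (fun i => if i == 0 then q else q + a *: (z - q)),
    (fun i => if i == 0 then 1 - a^-1 else a^-1); split.
  + by move=> i; case: ifP.
  + by rewrite !big_ord_recl big_ord0 /= addr0 subrK.
  + rewrite !big_ord_recl big_ord0 /= addr0 scalerBl scale1r scalerDr scalerA.
    by rewrite mulVf ?gt_eqF // scale1r addrA subrK addrC subrK.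
- split=> //; exists e => // t /Fhull tU; exact: eF.
Qed.

(** * Label counts in Q and on the section of Q' by H *)

Lemma split_lshift m n (i : 'I_m) : split (lshift n i) = inl i.
Proof. exact: (unsplitK (inl i)). Qed.

Lemma split_rshift m n (j : 'I_n) : split (rshift m j) = inr j.
Proof. exact: (unsplitK (inr j)). Qed.

Lemma card_split_ord m n (D : {set 'I_(m + n)}) :
  #|D| = (#|[set i | lshift n i \in D]| + #|[set j | rshift m j \in D]|)%N.
Proof.
have cE (T : finType) (A : {set T}) :
    #|A| = (\sum_i if i \in A then 1 else 0)%N.
  by rewrite -sum1_card big_mkcond.
by rewrite !cE big_split_ord; congr addn; apply: eq_bigr => i _; rewrite inE.
Qed.

(** Q has the form [G z <= 0], [s z = 1] with homogeneous rows, as [card_tight_le] requires. *)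
Lemma card_labQ_le (R : realFieldType) m n (B : 'M[R]_(m, n)) q :
  nondegenerateQ B -> polyQ B q -> (#|labQ B q| <= m)%N.
Proof.
pose G : 'M[R]_(m + n, m + 1) := block_mx (- 1%:M) 0 B^T (const_mx (-1)).
pose s : 'rV[R]_(m + 1) := row_mx (const_mx 1) 0.
have Gl z i : (G *m z) (lshift n i) 0 = - qx z i 0.
  by rewrite -[z]vsubmxK mul_block_col col_mxEu mul0mx addr0 mulNmx mul1mx
    /qx col_mxKu mxE.
have Gr z j : (G *m z) (rshift m j) 0 = ((qx z)^T *m B) 0 j - qpi2 z.
  rewrite -[z]vsubmxK mul_block_col col_mxEd /qx /qpi2 col_mxKu col_mxEd mxE.
  rewrite -[B^T *m _]trmxK trmx_mul trmxK mxE; congr (_ + _).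
  by rewrite mxE big_ord1 mxE mulN1r.
have sE z : (s *m z) 0 0 = \sum_i qx z i 0.
  rewrite -[z]vsubmxK mul_row_col mul0mx addr0 const1_mul.
  by rewrite /qx col_mxKu mxE mulr1n.
move=> nd; apply: (@card_tight_le _ _ _ _ G s _ _ _ _ nd) => [z|z k].
  split=> [[z0 zB z1]|[Gz sz]].
    split=> [k|]; last by rewrite sE.
    by case: (split_ordP k) => i ->; rewrite ?Gl ?Gr ?oppr_le0.
  split=> [i|j|]; last by rewrite -sE.
    by rewrite -oppr_le0 -Gl.
  by rewrite -Gr.
rewrite inE; case: (split_ordP k) => i ->.
  by rewrite Gl oppr_eq0.
by rewrite Gr.
Qed.

(** Dropping [lambda] maps a point of Q' on H to a point of Q with the same labels. *)
Lemma card_labQ'_le (R : realFieldType) m n (C : 'M[R]_(m, n)) beta alpha w :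
  nondegenerateQ (C + alpha *m beta^T) -> polyQ' C beta w ->
  wlambda w = \sum_i alpha i 0 * wx w i 0 ->
  (#|labQ' C beta w| <= m)%N.
Proof.
move=> nd [w0 wC w1] h; pose q : 'cV[R]_(m + 1) := col_mx (wx w) (wpi2 w)%:M.
have qxE : qx q = wx w by rewrite /qx col_mxKu.
have qpE : qpi2 q = wpi2 w by rewrite /qpi2 col_mxEd mxE mulr1n.
have -> : labQ' C beta w = labQ (C + alpha *m beta^T) q.
  apply/setP => k; rewrite !inE qxE qpE; case: split => // j.
  by rewrite row_mul_addE -h.
apply: card_labQ_le => //; split; rewrite qxE // => j.
by rewrite row_mul_addE -h qpE.
Qed.

(** * The index at the point on H *)

(** In the product of the two identities the positive factors do not affect the sign, which leaves
    [- sg h = (-1) ^+ k * sg (a * b)]. *)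
Lemma sg_index (R : realFieldType) k (s1 s2 p1 p2 r a b h e1 e2 : R) :
  0 < p1 -> 0 < p2 -> 0 < r -> s1 * s2 = (-1) ^+ k ->
  p1 * e1 = s1 * a -> h * p2 * e2 = s2 * r * b -> Num.sg (e1 * e2) = -1 ->
  (-1) ^+ (k + 1) * Num.sg (a * b) = Num.sg h.
Proof.
move=> p1_gt0 p2_gt0 r_gt0 s12 E1 E2 se.
have E : p1 * p2 * h * (e1 * e2) = r * ((-1) ^+ k * (a * b)).
  rewrite -s12; transitivity (p1 * e1 * (h * p2 * e2)); first by ring.
  by rewrite E1 E2; ring.
move/(congr1 Num.sg): E; rewrite sgrM in se; rewrite !sgrM (gtr0_sg p1_gt0).
rewrite (gtr0_sg p2_gt0) (gtr0_sg r_gt0) !mul1r se sgrX sgrN1 => sE.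
by rewrite exprD expr1 mulrN1 mulNr -sE mulrN1 opprK.
Qed.

(** [p] bounds an average of positive entries; were that average zero, all weights [x i 0] would
    vanish. *)
Lemma payoff_gt0 (R : realFieldType) m n (B : 'M[R]_(m, n)) (x : 'cV_m) j p :
  (forall i j, 0 < B i j) -> (forall i, 0 <= x i 0) -> \sum_i x i 0 = 1 ->
  (x^T *m B) 0 j - p <= 0 -> 0 < p.
Proof.
move=> B_gt0 x0 x1; rewrite subr_le0; apply: lt_le_trans.
rewrite mxE lt0r sumr_ge0 => [|i _]; last by rewrite mulr_ge0 ?mxE // ltW.
rewrite andbT; apply/eqP => /eqP; rewrite psumr_eq0 => [/allP e|i _]; last first.
  by rewrite mulr_ge0 ?mxE // ltW.
have := oner_neq0 R; rewrite -x1 big1 ?eqxx // => i _; apply/eqP.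
have := e i (mem_index_enum i).
by rewrite mxE mulf_eq0 (gt_eqF (B_gt0 _ _)) orbF.
Qed.

(** By counting, the labels of [v] and [t] partition all labels, while [v] and [w] share a single
    label [l], so [w] has the labels of [t] and [l]. Hence [I = X], and [J] is [Y], without [l] if
    [l] is a column. The determinant formulas for these sets then combine by [sg_index]. *)
Lemma index_on_edge (R : realFieldType) m n (A C : 'M[R]_(m, n))
    (beta : 'cV_n) (alpha : 'cV_m) (u : point R m n) (t : 'cV_(m + 2)) :
  (forall i j, 0 < A i j) -> (forall i j, 0 < (C + alpha *m beta^T) i j) ->
  Defs.polyP A u.1 -> polyQ' C beta u.2 -> polyQ' C beta t ->
  labP A u.1 :|: labQ' C beta u.2 = setT ->
  labP A u.1 :|: labQ' C beta t = setT ->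
  #|labP A u.1| = n -> #|labQ' C beta u.2| = (m + 1)%N ->
  (#|labQ' C beta t| <= m)%N ->
  wlambda t = \sum_i alpha i 0 * wx t i 0 -> Defs.sign A C beta u = -1 ->
  nash_index A (C + alpha *m beta^T) (wx t) (vy u.1) =
  Num.sg (- (wlambda u.2 - \sum_i alpha i 0 * wx u.2 i 0)).
Proof.
case: u => v w /= A_gt0 B_gt0 [vA v0 v1] [w0 wC w1] [t0 tC t1].
set D := labP A v; set W := labQ' C beta w; set T := labQ' C beta t.
move=> DW DT cD cW cT th; rewrite /Defs.sign /=.
set X := best_rows A _; set Y := best_cols C beta _.
have DP i : (lshift n i \in D) = (i \in X).
  by rewrite !inE split_lshift subr_eq0.
have DPc j : (rshift m j \in D) = (vy v j 0 == 0) by rewrite inE split_rshift.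
have WP i : (lshift n i \in W) = (wx w i 0 == 0) by rewrite inE split_lshift.
have WPc j : (rshift m j \in W) = (j \in Y).
  by rewrite !inE split_rshift subr_eq0.
have TP i : (lshift n i \in T) = (wx t i 0 == 0) by rewrite inE split_lshift.
have TPc j : (rshift m j \in T) =
    (((wx t)^T *m C) 0 j + beta j 0 * wlambda t - wpi2 t == 0).
  by rewrite inE split_rshift.
have cDT : #|D :&: T| = 0%N.
  have := cardsUI D T; rewrite DT cardsT card_ord cD.
  have aux a b c : (m + n + a = n + b -> b <= c -> c = m -> a = 0)%N by lia.
  by move/aux/(_ cT); apply.
have cDW : #|D :&: W| = 1%N.
  have := cardsUI D W; rewrite DW cardsT card_ord cD cW.
  have aux a : (m + n + a = n + (m + 1) -> a = 1)%N by lia.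
  exact: aux.
have TE k : (k \in T) = (k \notin D).
  have /setP/(_ k) := DT; rewrite in_setU in_setT.
  have /eqP := cDT; rewrite cards_eq0 => /eqP/setP/(_ k).
  rewrite in_setI in_set0.
  by case: (k \in D); case: (k \in T).
have DWT k : (k \in D) || (k \in W).
  by have /setP/(_ k) := DW; rewrite in_setU in_setT.
have [l DWl] : exists l, D :&: W = [set l] by apply/cards1P; rewrite cDW.
have WE k : (k \in W) = (k == l) || (k \in T).
  have /setP/(_ k) := DWl; rewrite in_setI in_set1 TE; have := DWT k.
  by case: (k \in D) => /= [_ ->|-> _]; rewrite ?orbF ?orbT.
have lD : l \in D.
  by have /setP/(_ l) := DWl; rewrite in_setI in_set1 eqxx => /andP[].
have lT : l \notin T by rewrite TE negbK.
have -> : [pick k in D :&: W] = Some l.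
  by case: pickP => [k|/(_ l)]; rewrite DWl inE ?eqxx // => /eqP ->.
rewrite /nash_index.
have -> : [set i | 0 < wx t i 0] = X.
  by apply/setP => i; rewrite inE lt0r t0 andbT -TP TE negbK DP.
set J := [set j | 0 < vy v j 0].
have JD j : (j \in J) = (rshift m j \notin D) by rewrite inE lt0r v0 andbT DPc.
have cXJ : #|X| = #|J|.
  have := card_split_ord D; rewrite cD.
  have -> : [set i | lshift n i \in D] = X by apply/setP => i; rewrite inE DP.
  have -> : [set j | rshift m j \in D] = ~: J.
    by apply/setP => j; rewrite in_set in_setC JD negbK.
  have := cardsC J; rewrite card_ord.
  have aux a b c : (a + b = n -> n = c + b -> c = a)%N by lia.
  exact: aux.
have v0J j : j \notin J -> vy v j 0 = 0 by rewrite JD negbK DPc => /eqP.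
have AX i : i \in X -> (A *m vy v) i 0 = vpi1 v by rewrite inE => /eqP.
have tX i : i \notin X -> wx t i 0 = 0 by rewrite -DP -TE TP => /eqP.
have wX i : i \notin X -> wx w i 0 = 0.
  by rewrite -DP -TE => iT; apply/eqP; rewrite -WP WE iT orbT.
have wY j : j \in Y ->
    ((wx w)^T *m C) 0 j + beta j 0 * wlambda w - wpi2 w = 0.
  by rewrite inE => /eqP ->; rewrite subrr.
(* Coordinates that sum to [1] cannot be absent; the indices obtained serve to bound both payoffs
   from below. *)
have [i0 _] : exists i : 'I_m, true.
  case: (pickP 'I_m) => [i|m0]; first by exists i.
  by have := oner_neq0 R; rewrite -w1 big1 ?eqxx // => i; have := m0 i.
have [j0 _] : exists j : 'I_n, true.
  case: (pickP 'I_n) => [j|n0]; first by exists j.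
  by have := oner_neq0 R; rewrite -v1 big1 ?eqxx // => j; have := n0 j.
have p1_gt0 : 0 < vpi1 v.
  apply: (@payoff_gt0 _ _ _ A^T (vy v) i0) => // [i j|]; first by rewrite mxE.
  by rewrite -trmx_mul mxE.
have p2_gt0 : 0 < wpi2 t.
  by apply: (payoff_gt0 (j := j0) B_gt0 t0 t1); rewrite row_mul_addE -th.
have tJ j : j \in J ->
    ((wx t)^T *m C) 0 j + beta j 0 * wlambda t - wpi2 t = 0.
  by rewrite JD -TE TPc => /eqP.
case: (split_ordP l) => l' lE.
- have YJ : Y = J.
    by apply/setP => j; rewrite JD -TE -WPc WE lE eq_rlshift.
  have r_gt0 : 0 < wx t l' 0 by rewrite lt0r t0 andbT -TP -lE.
  have l0 : wx w l' 0 = 0 by apply/eqP; rewrite -WP -lE WE eqxx.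
  rewrite YJ => sE; rewrite YJ in wY.
  have E1 := detr_Ev_row cXJ v1 v0J AX.
  have E2 := detr_Ew_row cXJ t1 w1 tX wX tJ wY l0 th.
  (* Makes the sign factor [s2 = 1] of [sg_index] visible. *)
  rewrite -[X in _ = X * _]mul1r in E2.
  by apply: (sg_index p1_gt0 p2_gt0 r_gt0 _ E1 E2 sE); rewrite mulr1.
- have l'Y : l' \in Y by rewrite -WPc -lE WE eqxx.
  have [p pE] : exists p : 'I_#|Y|, enum_val p = l'.
    by exists (enum_rank_in l'Y l'); rewrite enum_rankK_in.
  have YJ : J = Y :\ enum_val p.
    apply/setP => j; rewrite JD -TE in_setD1 pE -WPc WE lE eq_rshift.
    by case: eqP => [->|//]; rewrite -lE (negPf lT).
  have cXY : #|X|.+1 = #|Y|.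
    by rewrite cXJ YJ (cardsD1 (enum_val p) Y) enum_valP.
  (* The slack of column [l] at [t] is positive because [l] is not a label of [t]. *)
  pose r := - (((wx t)^T *m C) 0 l' + beta l' 0 * wlambda t - wpi2 t).
  have r_gt0 : 0 < r by rewrite lt0r oppr_eq0 -TPc -lE lT oppr_ge0 tC.
  have l0 : vy v (enum_val p) 0 = 0 by apply/eqP; rewrite pE -DPc -lE.
  have v0Y j : j \notin Y -> vy v j 0 = 0.
    by move=> jY; apply: v0J; rewrite YJ in_setD1 (negPf jY) andbF.
  have tY j : j \in Y -> ((wx t)^T *m C) 0 j + beta j 0 * wlambda t - wpi2 t =
      if j == enum_val p then - r else 0.
    move=> jY; case: eqP => [->|/eqP jp]; first by rewrite pE opprK.
    by apply: tJ; rewrite YJ in_setD1 jp.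
  rewrite -pE YJ => sE.
  have E1 := detr_Ev_col cXY v1 v0Y AX l0.
  have E2 := detr_Ew_col cXY t1 w1 tX wX tY wY th.
  apply: (sg_index p1_gt0 p2_gt0 r_gt0 _ E1 E2 sE).
  by rewrite mulrCA -expr2 sqrr_sign mulr1.
Qed.

(** * Orientation of the edge and sign of the index *)

Theorem proposition11 (R : realFieldType) (m n : nat)
    (A C : 'M[R]_(m, n)) (beta : 'cV[R]_n) (alpha : 'cV[R]_m)
    (A_neq0 : A != 0) (C_neq0 : C != 0) (beta_neq0 : beta != 0)
    (P_nondeg : nondegenerateP A) (Q'_nondeg : nondegenerateQ' C beta)
    (G_nondeg : nondegenerate_game A (C + alpha *m beta^T))
    (A_gt0 : forall i j, 0 < A i j)
    (B_gt0 : forall i j, 0 < (C + alpha *m beta^T) i j)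
    (u u' z : point R m n) :
  let h (w : 'cV[R]_(m + 2)) := wlambda w - \sum_i alpha i 0 * wx w i 0 in
  let x := wx z.2 in
  let y := vy z.1 in
  edgeN A C beta u u' ->
  segment u u' z ->
  h z.2 = 0 ->
  nash A (C + alpha *m beta^T) x y ->
  oriented A C beta u u' ->
  (h u.2 <= 0 /\ 0 <= h u'.2 -> nash_index A (C + alpha *m beta^T) x y = 1) /\
  (~ (h u.2 <= 0 /\ 0 <= h u'.2) ->
   nash_index A (C + alpha *m beta^T) x y = -1).
Proof.
move=> h x y [[uv [[uP uQ] uL]] _ _ _ uN] zu hz _ ori.
have [zP' zQ] := uN z zu; case: (zP') => zP zQ'.
have [vP vQ] := vertex_prod uv.
have cP : #|labP A u.1| = n by apply: card_vertex P_nondeg vP.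
have cQ : #|labQ' C beta u.2| = (m + 1)%N by apply: card_vertex Q'_nondeg vQ.
have cQ_le w : polyQ' C beta w -> h w = 0 -> (#|labQ' C beta w| <= m)%N.
  move=> wQ /eqP; rewrite subr_eq0 => /eqP hw.
  exact: card_labQ'_le G_nondeg.2 wQ hw.
(* The vertex has [m + 1] labels in Q', one more than a point on H can have. *)
have hu0 : h u.2 != 0.
  by apply/eqP => /(cQ_le _ uQ); rewrite cQ addn1 ltnn.
case: ori => [[_ segE]|[su segE]].
  (* An edge in P keeps [w] fixed, so [w] itself would lie on H. *)
  by have [_ z2] := (segE z).1 zu; rewrite z2 in hz; rewrite hz eqxx in hu0.
have [z1 [_ zL]] := (segE z).1 zu.
have th : wlambda z.2 = \sum_i alpha i 0 * wx z.2 i 0.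
  by apply/eqP; rewrite -subr_eq0; apply/eqP.
have -> : nash_index A (C + alpha *m beta^T) x y = Num.sg (- h u.2).
  rewrite /y z1; apply: index_on_edge => //.
  exact: cQ_le.
rewrite sgrN; split=> [[hu _]|hu].
  by rewrite ltr0_sg ?opprK // lt_neqAle hu0.
rewrite gtr0_sg // lt0r hu0 leNgt; apply/negP => hu_lt0; apply: hu.
split; first exact: ltW.
(* [h] is affine along the edge and zero at [z], so it cannot be negative at both ends. *)
case: zu => a /andP[a0 a1] zE.
have hL : h z.2 = (1 - a) * h u.2 + a * h u'.2.
  rewrite zE /h /wlambda /wx !mxE.
  have -> : \sum_i alpha i 0 * usubmx ((1 - a) *: u + a *: u').2 i 0 =
      (1 - a) * (\sum_i alpha i 0 * usubmx u.2 i 0) +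
      a * (\sum_i alpha i 0 * usubmx u'.2 i 0).
    rewrite !mulr_sumr -big_split; apply: eq_bigr => i _; rewrite !mxE /=.
    by ring.
  by ring.
rewrite leNgt; apply/negP => hu'_lt0.
move: a0 a1 hu_lt0 hu'_lt0 hL; rewrite hz; move: (h u.2) (h u'.2) => p q.
by clear -a => a0 a1 p_lt0 q_lt0; nra.
Qed.
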